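(* Let $R=\mathbb{Z}\oplus\bigoplus_{i\ge 1}\mathbb{Z}/2\mathbb{Z}$ be the commutative ring with componentwise addition and multiplication $(m,a)\cdot(n,b)=(mn,\,mb+na+ab)$. Then $R$ is a B\'ezout ring.
   Context: In the multiplication, $m,n\in\mathbb{Z}$, $a,b\in\bigoplus_{i\ge1}\mathbb{Z}/2\mathbb{Z}$, $ma=(ma_1,ma_2,\dots)$ and $ab=(a_1b_1,a_2b_2,\dots)$. A (commutative) ring is a B\'ezout ring if every finitely generated ideal is principal (the ring is not required to be a domain). *)

(* Defs.v *)
From HB Require Import structures.
From mathcomp Require Import all_boot all_order all_algebra.
From mathcomp Require Import finmap.
From mathcomp Require Import monalg.
From mathcomp Require Import ring.

Set Implicit Arguments.
Unset Strict Implicit.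
Unset Printing Implicit Defensive.

Import GRing.Theory.

Local Open Scope ring_scope.

Section Ideals.

Variable R : comPzRingType.

Definition is_ideal (I : R -> Prop) : Prop :=
  [/\ I 0,
      forall x y, I x -> I y -> I (x + y)
    & forall r x, I x -> I (r * x)].

Definition ideal_generated_by (s : seq R) (x : R) : Prop :=
  forall I : R -> Prop, is_ideal I -> (forall y, y \in s -> I y) -> I x.

Definition finitely_generated (I : R -> Prop) : Prop :=
  exists s : seq R, forall x, I x <-> ideal_generated_by s x.

Definition principal (I : R -> Prop) : Prop :=
  exists g : R, forall x, I x <-> ideal_generated_by [:: g] x.

Definition bezout_ring : Prop :=
  forall I : R -> Prop, is_ideal I -> finitely_generated I -> principal I.

End Ideals.

(* {malg G[K]} is used here only as the additive group of finitely supported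
   functions K -> G, i.e. the K-indexed direct sum of G; its convolution
   product (which needs a monoid structure on K) plays no role. The index
   k : nat stands for the summand number k + 1. *)
Definition Z2sum : Type := malg nat 'Z_2.

HB.instance Definition _ := GRing.Zmodule.copy Z2sum (malg nat 'Z_2).

Definition Z2sum_mul (a b : Z2sum) : Z2sum :=
  [malg k in msupp a => a@_k * b@_k].

Lemma Z2sum_mulE (a b : Z2sum) (k : nat) :
  (Z2sum_mul a b)@_k = a@_k * b@_k.
Proof. by rewrite mcoeffE; case: msuppP => // _; rewrite mul0r. Qed.

Lemma Z2sum_mulrzE (a : Z2sum) (m : int) (k : nat) :
  (a *~ m)@_k = a@_k *~ m.
Proof. by case: m => n; rewrite ?NegzE ?mulrNz -?pmulrn ?mcoeffMNn ?mcoeffMn. Qed.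

Definition ZZ2sum : Type := (int * Z2sum)%type.

HB.instance Definition _ := GRing.Zmodule.copy ZZ2sum (int * Z2sum)%type.

(* The integer multiple m a is the library's a *~ m. *)
Definition ZZ2sum_mul (x y : ZZ2sum) : ZZ2sum :=
  let: (m, a) := x in let: (n, b) := y in
  (m * n, b *~ m + a *~ n + Z2sum_mul a b).

Definition ZZ2sum_one : ZZ2sum := (1, 0).

Lemma ZZ2sumP (x y : ZZ2sum) :
  x.1 = y.1 -> (forall k, x.2@_k = y.2@_k) -> x = y.
Proof. by case: x y => [m a] [n b] /= -> /malgP ->. Qed.

Lemma ZZ2sum_mul1E (x y : ZZ2sum) : (ZZ2sum_mul x y).1 = x.1 * y.1.
Proof. by case: x y => [m a] [n b]. Qed.

Lemma ZZ2sum_mul2E (x y : ZZ2sum) k :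
  (ZZ2sum_mul x y).2@_k =
  x.1%:~R * y.2@_k + y.1%:~R * x.2@_k + x.2@_k * y.2@_k.
Proof.
case: x y => [m a] [n b] /=.
by rewrite 2!mcoeffD !Z2sum_mulrzE Z2sum_mulE !mulrzl.
Qed.

Lemma ZZ2sum_mulA : associative ZZ2sum_mul.
Proof.
move=> x y z; apply: ZZ2sumP => [|k]; rewrite ?ZZ2sum_mul1E ?mulrA //.
by rewrite !(ZZ2sum_mul2E, ZZ2sum_mul1E); ring.
Qed.

Lemma ZZ2sum_mulC : commutative ZZ2sum_mul.
Proof.
move=> x y; apply: ZZ2sumP => [|k]; first by rewrite !ZZ2sum_mul1E mulrC.
by rewrite !ZZ2sum_mul2E; ring.
Qed.

Lemma ZZ2sum_mul1l : left_id ZZ2sum_one ZZ2sum_mul.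
Proof.
move=> x; apply: ZZ2sumP => [|k]; first by rewrite ZZ2sum_mul1E mul1r.
by rewrite ZZ2sum_mul2E mcoeff0; ring.
Qed.

Lemma ZZ2sum_mulDl : left_distributive ZZ2sum_mul +%R.
Proof.
move=> x y z; apply: ZZ2sumP => [|k].
  by rewrite ZZ2sum_mul1E [LHS]mulrDl -!ZZ2sum_mul1E.
have addE (u v : ZZ2sum) : (u + v).2@_k = u.2@_k + v.2@_k by exact: mcoeffD.
have add1E (u v : ZZ2sum) : (u + v).1 = u.1 + v.1 by [].
by rewrite !(addE, ZZ2sum_mul2E) add1E; ring.
Qed.

Lemma ZZ2sum_one_neq0 : ZZ2sum_one != 0.
Proof. by []. Qed.

HB.instance Definition _ := GRing.Zmodule_isComNzRing.Build ZZ2sum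
  ZZ2sum_mulA ZZ2sum_mulC ZZ2sum_mul1l ZZ2sum_mulDl ZZ2sum_one_neq0.

(* Main.v *)
Require Import Defs.
From mathcomp Require Import all_boot all_order all_algebra.
From mathcomp Require Import finmap monalg ring.

Set Implicit Arguments.
Unset Strict Implicit.
Unset Printing Implicit Defensive.

Import GRing.Theory.

Local Open Scope ring_scope.

(** The maps [(m, a) |-> m + a_k mod 2] are ring morphisms to [F_2] which,
    together with [(m, a) |-> m], embed the ring in [Z * F_2^N]; the image
    consists of the [(m, c)] with [c_k = m mod 2] for almost all [k].  Given [x]
    and [y], the integer coordinate is handled by Bezout in [Z].  Outside the
    finite set [K] of places where [x] or [y] has a nonzero second component the
    [F_2]-coordinates follow from the integer one, while on [K] they can be
    prescribed freely: there the generator [g] has coordinates [x_k \/ y_k]. *)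

(** Induction on the list of generators: if [g] generates the ideal of the tail, then
    [s * x + t * g] lies in the ideal of the whole list and divides every generator. *)
Lemma bezout_ring_of_pairs (R : comPzRingType) :
  (forall x y : R, exists s t p q : R,
     x = p * (s * x + t * y) /\ y = q * (s * x + t * y)) ->
  bezout_ring R.
Proof.
move=> bez2 I _ [l Il].
suff [g gen_g dvd_g] : exists2 g, ideal_generated_by l g
    & forall y, y \in l -> exists p, y = p * g.
  exists g => x; rewrite Il; split=> [gen_x J idJ Jg | gen_x J idJ Jl].
    apply: gen_x => // y /dvd_g[p ->]; case: idJ => _ _; apply.
    by apply: Jg; rewrite mem_head.
  by apply: gen_x => // y /[!inE] /eqP ->; apply: gen_g.
elim: l {I Il} => [|x l [g gen_g dvd_g]]; first by exists 0 => // J [].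
have [s [t [p [q [xE gE]]]]] := bez2 x g.
exists (s * x + t * g) => [J idJ Jl | y].
  have [_ JD JM] := idJ; apply: JD; apply: JM.
    by apply: Jl; rewrite mem_head.
  by apply: gen_g => // y yl; apply: Jl; rewrite inE yl orbT.
rewrite inE => /predU1P[-> | /dvd_g[r ->]]; first by exists p.
by exists (r * q); rewrite -mulrA -gE.
Qed.

Lemma Z2_mulrr (a : 'Z_2) : a * a = a.
Proof. by case: a => [[|[|k]] ka] //; apply: val_inj. Qed.

Definition residue (k : nat) (x : ZZ2sum) : 'Z_2 := x.1%:~R + x.2@_k.

Lemma residueD k (x y : ZZ2sum) : residue k (x + y) = residue k x + residue k y.
Proof.
have addE : (x + y).2@_k = x.2@_k + y.2@_k by exact: mcoeffD.
have add1E : (x + y).1 = x.1 + y.1 by [].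
by rewrite /residue addE add1E; ring.
Qed.

Lemma residueM k (x y : ZZ2sum) : residue k (x * y) = residue k x * residue k y.
Proof.
by rewrite /residue [(x * y).1]ZZ2sum_mul1E [(x * y).2@_k]ZZ2sum_mul2E; ring.
Qed.

Lemma residue_inj (x y : ZZ2sum) :
  x.1 = y.1 -> (forall k, residue k x = residue k y) -> x = y.
Proof.
move=> xy1 xy2; apply: ZZ2sumP => // k.
by have := xy2 k; rewrite /residue xy1 => /addrI.
Qed.

(** Subtracting [m] makes [c k] the residue, not the second component, at each [k] in [K]. *)
Definition patch (m : int) (K : {fset nat}) (c : nat -> 'Z_2) : ZZ2sum :=
  (m, [malg k in K => c k - m%:~R]).

Lemma residue_patch k m K c :
  residue k (patch m K c) = if k \in K then c k else m%:~R.
Proof.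
by rewrite /residue mcoeffE; case: ifP => _; rewrite ?addr0 // addrC subrK.
Qed.

Lemma residue_notin_supp k (x : ZZ2sum) :
  k \notin msupp x.2 -> residue k x = x.1%:~R.
Proof. by move=> /mcoeff_outdom xk; rewrite /residue xk addr0. Qed.

(** On a finite set the quotient can take the residues of [x] itself; elsewhere all residues reduce
    integer coordinates, where [q] is the quotient. *)
Lemma ZZ2sum_dvd (g x : ZZ2sum) (q : int) :
  x.1 = q * g.1 -> (forall k, residue k x = residue k x * residue k g) ->
  exists p : ZZ2sum, x = p * g.
Proof.
move=> x1E xgE; pose K := (msupp g.2 `|` msupp x.2)%fset.
exists (patch q K (residue^~ x)); apply: residue_inj => [|k].
  by rewrite [RHS]ZZ2sum_mul1E.
rewrite residueM residue_patch; case: ifPn => // /[!in_fsetU] /norP[kg kx].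
by rewrite !residue_notin_supp // x1E intrM.
Qed.

Theorem proposition40 : bezout_ring ZZ2sum.
Proof.
apply: bezout_ring_of_pairs => x y.
have [u [v uvE]] := Bezoutz x.1 y.1.
pose K := (msupp x.2 `|` msupp y.2)%fset.
pose s := patch u K (residue^~ x).
(* By idempotence, [g] then has residue [x_k + (1 - x_k) * y_k] on [K], which is [x_k \/ y_k]. *)
pose t := patch v K (fun k => residue k y * (1 - residue k x)).
pose g := s * x + t * y.
have g1 : g.1 = gcdz x.1 y.1.
  by rewrite -uvE -[u]/s.1 -[v]/t.1 -!ZZ2sum_mul1E.
have gK k : k \in K ->
    residue k g = residue k x + residue k y - residue k x * residue k y.
  move=> kK; rewrite residueD !residueM !residue_patch kK Z2_mulrr.
  by rewrite mulrAC Z2_mulrr; ring.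
have gNK k : k \notin K ->
  [/\ residue k g = (gcdz x.1 y.1)%:~R, residue k x = x.1%:~R
    & residue k y = y.1%:~R].
  move=> kK; rewrite residueD !residueM !residue_patch (negPf kK).
  move: kK => /[!in_fsetU] /norP[kx ky].
  by rewrite !residue_notin_supp // -!intrM -intrD uvE.
have /dvdzP[a xE] := dvdz_gcdl x.1 y.1.
have /dvdzP[b yE] := dvdz_gcdr x.1 y.1.
have [p pE] : exists p, x = p * g.
  apply: (@ZZ2sum_dvd _ _ a) => [|k]; first by rewrite g1.
  have [/gK -> | /gNK[-> -> _]] := boolP (k \in K).
    (* Absorption: [x_k * (x_k \/ y_k) = x_k]. *)
    by rewrite mulrBr mulrDr mulrA Z2_mulrr addrK.
  (* Off [K], [x_k] is [a * d] modulo 2 with [d] the gcd, and [d * d = d] there. *)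
  by rewrite {1 2}xE intrM -mulrA Z2_mulrr.
have [q qE] : exists q, y = q * g.
  apply: (@ZZ2sum_dvd _ _ b) => [|k]; first by rewrite g1.
  have [/gK -> | /gNK[-> _ ->]] := boolP (k \in K).
    rewrite mulrBr mulrDr Z2_mulrr mulrCA Z2_mulrr [_ * residue k x]mulrC.
    by rewrite addrAC subrr add0r.
  by rewrite {1 2}yE intrM -mulrA Z2_mulrr.
by exists s, t, p, q.
Qed.
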